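(* Let $\dot x=f(x)$ be a homogeneous polynomial vector field on $\mathbb{R}^n$. Suppose there exists a homogeneous polynomial Lyapunov function $V$ such that $V$ and $-\dot V$ are positive definite. Then there also exists a homogeneous polynomial Lyapunov function $W$ such that $W$ is a sum of squares and $-\dot W$ is a sum of squares.
   Context: A polynomial vector field $\dot x=f(x)$, $f:\mathbb{R}^n\to\mathbb{R}^n$, with $f(0)=0$, is homogeneous if all entries of $f$ are homogeneous polynomials of the same degree. For a polynomial $V$, $\dot V(x):=\langle\nabla V(x),f(x)\rangle$. A homogeneous polynomial $p$ is positive definite if $p(x)>0$ for all $x\neq0$. A homogeneous polynomial Lyapunov function (for global asymptotic stability of the origin) is a homogeneous polynomial $V$ such that $V$ and $-\dot V$ are both positive definite and $V$ is radially unbounded and vanishes at the origin (automatic for a positive definite form of positive degree). A polynomial is a sum of squares if it is a finite sum of squares of real polynomials. *)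

(* Defs.v *)
From mathcomp Require Import all_boot all_order all_algebra.
From mathcomp Require Import reals mpoly.

Set Implicit Arguments.
Unset Strict Implicit.
Unset Printing Implicit Defensive.

Import Order.TTheory GRing.Theory Num.Theory.

Local Open Scope ring_scope.

(* A polynomial vector field on R^n is the family of its n components. A point
   x of R^n is a row vector; [x ord0] is the associated map 'I_n -> R. *)

Definition homogeneous (R : realType) (n : nat) (p : {mpoly R[n]}) : Prop :=
  exists d : nat, p \is d.-homog.

(* One degree d serves for all the components; the zero component is allowed,
   as 0 is homogeneous of every degree. *)
Definition homogeneous_vector_field (R : realType) (n : nat)
    (f : 'I_n -> {mpoly R[n]}) : Prop :=
  (forall i, (f i).@[(0 : 'rV[R]_n) ord0] = 0) /\
  (exists d : nat, forall i, f i \is d.-homog).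

Definition lie_derivative (R : realType) (n : nat)
    (f : 'I_n -> {mpoly R[n]}) (V : {mpoly R[n]}) : {mpoly R[n]} :=
  \sum_(i < n) V^`M(i) * f i.

Definition positive_definite (R : realType) (n : nat) (p : {mpoly R[n]}) : Prop :=
  forall x : 'rV[R]_n, x != 0 -> 0 < p.@[x ord0].

Definition euclidean_norm (R : realType) (n : nat) (x : 'rV[R]_n) : R :=
  Num.sqrt (\sum_(i < n) x ord0 i ^+ 2).

Definition radially_unbounded (R : realType) (n : nat) (p : {mpoly R[n]}) : Prop :=
  forall M : R, exists r : R,
    forall x : 'rV[R]_n, r < euclidean_norm x -> M < p.@[x ord0].

Definition sum_of_squares (R : realType) (n : nat) (p : {mpoly R[n]}) : Prop :=
  exists s : seq {mpoly R[n]}, p = \sum_(q <- s) q ^+ 2.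

Definition homogeneous_lyapunov (R : realType) (n : nat)
    (f : 'I_n -> {mpoly R[n]}) (V : {mpoly R[n]}) : Prop :=
  [/\ homogeneous V,
      V.@[(0 : 'rV[R]_n) ord0] = 0,
      radially_unbounded V,
      positive_definite V
    & positive_definite (- lie_derivative f V)].

(* Main.v *)
Require Import Defs.
From mathcomp Require Import all_boot all_order all_algebra.
From mathcomp Require Import reals.
From mathcomp Require boolp classical_sets topology normedtype.
From mathcomp Require derive realfun.
From mathcomp Require Import ring lra zify.

(** Along the flow, [(V^(2k+2))' = (2k+2) V^(2k+1) V'], and [V^(2k+2)] is a
    square. So [W = V^(2k+2)] works as soon as [(V^2)^k * (V * (- V'))] is a sum
    of squares. Both [g = V^2] and [h = V * (- V')] are positive definite forms,
    and the existence of such a [k] is a theorem of Scheiderer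
    ([scheiderer_power_denominator]). The proof given here is elementary; write
    [s] for the sum of the squares of the variables, and [p <=sos q] when [q - p]
    is a sum of squares.

    Everything rests on one easy fact ([l1_le_sos]): [C s^k] dominates every form
    of degree [2 k] whose coefficients have absolute values of sum at most [C].
    A statement that holds up to a small error therefore holds exactly, provided
    that there is some slack, and compactness of the sphere provides the slack.

    The first step is Reznick's theorem ([reznick_uniform_denominator]): if [h] is
    positive definite then [s^N h] is a sum of squares for some [N]. For a
    nonnegative form [q], averaging [q(u) (u . X)^j] over the Gaussian vector [u]
    gives, by integration by parts, a multiple of [s^l (q + small)]
    ([polar_gauss_asymptotic]). The Gaussian law is replaced with rescaled simple
    random walks, whose moments converge ([gauss_approx]). For these the average
    is a finite sum, and it is visibly a sum of squares when [j] is even.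

    The second step replaces the denominator [s] by [g]. Reznick's theorem for
    [g - e s^d] and the identity of [wormann_trick] show that some power of [g]
    dominates a power of [s]; a multiple of the latter dominates the former. In
    the picture where [g = 1], the form [s] is thus bounded between two positive
    constants, a polynomial in [1 - c s] approximates the inverse of [s^N], and
    multiplying [s^N h] by it removes the denominator
    ([sos_clear_denominator]). *)

Set Implicit Arguments.
Unset Strict Implicit.
Unset Printing Implicit Defensive.

Import Order.TTheory GRing.Theory Num.Theory.

Local Open Scope ring_scope.

(** * Minimum of a polynomial on the sphere *)

Section Compactness.

Import classical_sets boolp topology normedtype derive realfun.
Import numFieldNormedType.Exports.
Local Open Scope classical_set_scope.

Lemma polynomial_function_continuous (R : realType) (n : nat)
    (t : seq (R * ('I_n -> nat))) :
  continuous (fun x : 'rV[R]_n =>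
    \sum_(cm <- t) cm.1 * \prod_i x ord0 i ^+ cm.2 i : R).
Proof.
have contX i k : continuous (fun x : 'rV[R]_n => x ord0 i ^+ k : R).
  move=> x; apply: (@continuous_comp _ _ _ (fun x : 'rV[R]_n => x ord0 i)
    (fun y : R => y ^+ k)); first exact: coord_continuous.
  exact: exprn_continuous.
have contM (m : 'I_n -> nat) :
    continuous (fun x : 'rV[R]_n => \prod_i x ord0 i ^+ m i : R).
  elim: (index_enum _) => [|i s IHs].
    by under eq_fun do rewrite big_nil; exact: cst_continuous.
  under eq_fun do rewrite big_cons.
  by move=> x; apply: (@continuousM _ _ (fun x : 'rV[R]_n => x ord0 i ^+ m i));
    [exact: contX|exact: IHs].
elim: t => [|cm t IH].
  by under eq_fun do rewrite big_nil; exact: cst_continuous.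
under eq_fun do rewrite big_cons.
move=> x.
apply: (@continuousD _ R^o _ (fun x : 'rV[R]_n => cm.1 * _)); last exact: IH.
apply: (@continuousM _ _ (fun=> cm.1)); first exact: cst_continuous.
exact: contM.
Qed.

(** The unit sphere is compact. The polynomial is given by a list of
    coefficients and exponents, so that the argument stays within plain
    functions on row vectors. *)
Lemma polynomial_sphere_min (R : realType) (n : nat)
    (t : seq (R * ('I_n -> nat)))
    (f := fun x : 'rV[R]_n =>
       \sum_(cm <- t) cm.1 * \prod_i x ord0 i ^+ cm.2 i) :
  (forall x : 'rV[R]_n, x != 0 -> 0 < f x) ->
  exists2 e : R, 0 < e &
    forall x : 'rV[R]_n, \sum_i x ord0 i ^+ 2 = 1 -> e <= f x.
Proof.
move=> f_gt0.
pose A : set 'rV[R]_n := [set x | \sum_i x ord0 i ^+ 2 = 1 :> R].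
have A_le1 x : A x -> forall i, `|x ord0 i| <= 1.
  move=> Ax i; rewrite -(expr_le1 (n := 2)) // real_normK ?num_real //.
  by rewrite -Ax (bigD1 i) //= lerDl sumr_ge0 // => j _; exact: sqr_ge0.
have [A0|] := pselect (A !=set0); last first.
  by move=> A0; exists 1 => // x Ax; case: A0; exists x.
have cA : compact A.
  apply: bounded_closed_compact.
    exists 1; split=> // M M1 x Ax /=; rewrite [leLHS]/Num.norm /= mx_normrE.
    apply/bigmax_leP; split=> /= [|[i j] _ /=].
      exact: le_trans ler01 (ltW M1).
    by rewrite (ord1 i); exact: le_trans (A_le1 x Ax j) (ltW M1).
  have sqE (x : 'rV[R]_n) i :
      1 * \prod_j x ord0 j ^+ (2 * (j == i)) = x ord0 i ^+ 2.
    rewrite mul1r (bigD1 i) //= eqxx big1 ?mulr1 // => j /negPf ->.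
    by rewrite muln0.
  have -> : A = (fun x : 'rV[R]_n =>
      \sum_(cm <- [seq (1 : R, fun j => (2 * (j == i))%N) | i <- enum 'I_n])
        cm.1 * \prod_i x ord0 i ^+ cm.2 i : R) @^-1` [set 1].
    by apply/seteqP; split=> x; rewrite /A /= big_map big_enum /=;
      rewrite (eq_bigr _ (fun i _ => sqE x i)).
  apply: closed_comp; first by move=> x _; exact: polynomial_function_continuous.
  exact: closed_eq.
have [c cA' cmin] := EVT_min_rV A0 cA
  (continuous_subspaceT (@polynomial_function_continuous R n t)).
exists (f c); last by move=> x Ax; apply: cmin; rewrite inE.
apply: f_gt0; apply: contraTneq cA' => ->; apply/negP; rewrite inE /A /=.
under eq_bigr do rewrite mxE expr0n.
by rewrite big1 // => /esym/eqP; rewrite oner_eq0.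
Qed.

End Compactness.

From mathcomp Require Import mpoly.

(** * The preorder of sums of squares *)

Local Notation "p '<=sos' q" := (sum_of_squares (q - p)) (at level 70).

Lemma bernoulli (R : realDomainType) (x : R) k :
  -1 <= x -> 1 + k%:R * x <= (1 + x) ^+ k.
Proof.
move=> x1; elim: k => [|k IH]; first by rewrite expr0 mul0r addr0.
have k0 : 0 <= k%:R :> R by [].
rewrite exprS -natr1; nra.
Qed.

Lemma exists_expr_lt (R : archiRealFieldType) (x e : R) :
  0 <= x -> x < 1 -> 0 < e -> exists k, x ^+ k < e.
Proof.
move=> x0 x1 e0; exists (Num.bound ((e * (1 - x))^-1)); set k := Num.bound _.
have ex0 : 0 < e * (1 - x) by nra.
have : (e * (1 - x))^-1 < k%:R by apply: archi_boundP; rewrite invr_ge0 ltW.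
rewrite -[ltLHS]mul1r ltr_pdivrMr // => kP.
have : 1 + k%:R * (1 - x) <= (1 + (1 - x)) ^+ k by apply: bernoulli; lra.
have : x ^+ k * (1 + (1 - x)) ^+ k <= 1.
  by rewrite -exprMn exprn_ile1 //; nra.
have k0 : 0 <= k%:R :> R by [].
have xk0 : 0 <= x ^+ k by rewrite exprn_ge0.
rewrite ltNge => xk1 Bk; apply/negP => ek.
have : e * (1 + k%:R * (1 - x)) <= 1.
  by apply: le_trans xk1; apply: ler_pM => //; nra.
nra.
Qed.

Section SosOrder.

Variables (R : realType) (n : nat).
Implicit Types p q r G S h t : {mpoly R[n]}.

Lemma sos0 : sum_of_squares (0 : {mpoly R[n]}).
Proof. by exists [::]; rewrite big_nil. Qed.

Lemma sos_sqr p : sum_of_squares (p ^+ 2).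
Proof. by exists [:: p]; rewrite big_seq1. Qed.

Lemma sosD p q : sum_of_squares p -> sum_of_squares q -> sum_of_squares (p + q).
Proof. by move=> [s ->] [t ->]; exists (s ++ t); rewrite big_cat. Qed.

Lemma sos_sum (I : Type) (s : seq I) (P : pred I) (F : I -> {mpoly R[n]}) :
  (forall i, P i -> sum_of_squares (F i)) -> sum_of_squares (\sum_(i <- s | P i) F i).
Proof. by move=> sosF; apply: big_ind => //; [exact: sos0|exact: sosD]. Qed.

Lemma sosM p q : sum_of_squares p -> sum_of_squares q -> sum_of_squares (p * q).
Proof.
move=> [s ->] [t ->]; rewrite mulr_suml; apply: sos_sum => a _.
by rewrite mulr_sumr; apply: sos_sum => b _; rewrite -exprMn; exact: sos_sqr.
Qed.

Lemma sosC (c : R) : 0 <= c -> sum_of_squares (c%:MP : {mpoly R[n]}).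
Proof. by move=> c0; rewrite -(sqr_sqrtr c0) rmorphXn /=; exact: sos_sqr. Qed.

Lemma sosX p k : sum_of_squares p -> sum_of_squares (p ^+ k).
Proof.
move=> p0; elim: k => [|k IH]; last by rewrite exprS; exact: sosM.
by rewrite expr0 -(expr1n _ 2); exact: sos_sqr.
Qed.

Lemma sosZ (c : R) p : 0 <= c -> sum_of_squares p -> sum_of_squares (c *: p).
Proof. by move=> c0 p0; rewrite -mul_mpolyC; apply: sosM => //; exact: sosC. Qed.

Lemma sos_leX p q k :
  sum_of_squares p -> p <=sos q -> p ^+ k <=sos q ^+ k.
Proof.
move=> p0 pq.
have q0 : sum_of_squares q by rewrite -(subrK p q) addrC; exact: sosD.
rewrite subrXX; apply: sosM => //; apply: sos_sum => i _.
by apply: sosM; exact: sosX.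
Qed.

(** Woermann's trick: the cofactor [S] in [S * (G - c S)] disappears at the cost
    of squaring, since
    [G^2 - c^2 S^2 = (G - c S)^2 + 2 c S (G - c S)]. *)
Lemma wormann_trick (c : R) S G :
  0 <= c -> sum_of_squares (S * (G - c *: S)) -> c ^+ 2 *: S ^+ 2 <=sos G ^+ 2.
Proof.
move=> c0 SG.
have -> : G ^+ 2 - c ^+ 2 *: S ^+ 2 =
    (G - c *: S) ^+ 2 + (2 * c) *: (S * (G - c *: S)).
  by rewrite -!mul_mpolyC; ring.
by apply: sosD (sos_sqr _) (sosZ _ SG); rewrite mulr_ge0.
Qed.

(** If [S] and [G] are comparable in the preorder of sums of squares, a
    denominator [S^M] can be traded for a denominator [G^k]. In the picture
    where [G = 1], the hypotheses say that [S] lies between [1/C] and [1/c].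
    Hence [b = (1 - c S)^k] is a small nonnegative element, [1 - b] is a
    multiple of [S] by a sum of squares, and [(1 - b)^M] is both a multiple of
    [S^M] and close to [1]. So [(1 - b)^M h] is a sum of squares, and the error
    [(1 - (1 - b)^M) h] is absorbed by the slack [d t], because
    [h >= - B t]. *)
Lemma sos_clear_denominator (c C d B : R) (M : nat) G S h t :
  0 < c -> 0 < C -> 0 < d -> sum_of_squares S -> sum_of_squares G ->
  sum_of_squares t -> c *: S <=sos G -> G <=sos C *: S ->
  sum_of_squares (S ^+ M * h) -> sum_of_squares (h + B *: t) -> 
  exists k, sum_of_squares (G ^+ k * (h + d *: t)).
Proof.
move=> c0 C0 d0 S0 G0 t0 cSG GCS SMh hBt.
pose B' := Num.max B 0; pose u := c / (C + c); pose x := 1 - u.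
have B'0 : 0 <= B' by rewrite le_max lexx orbT.
have M0 : 0 <= M%:R :> R by [].
have Cc0 : 0 < C + c by lra.
have u0 : 0 < u by rewrite divr_gt0.
have u1 : u < 1 by rewrite ltr_pdivrMr //; lra.
have MB0 : 0 < M%:R * B' + 1 by nra.
have [k ksmall] : exists k, x ^+ k < d / (M%:R * B' + 1).
  by apply: exists_expr_lt; rewrite ?divr_gt0 // /x; lra.
pose Y := G - c *: S.
(* G - Y = c S, and S is at least G / (C + c) up to sums of squares. *)
have YxG : Y <=sos x *: G.
  have -> : x *: G - Y = u *: (C *: S - G) + (c * u) *: S.
    have cSE : c *: S = (u * (C + c)) *: S by rewrite divfK // gt_eqF.
    by rewrite /Y {1}cSE /x -!mul_mpolyC; ring.
  by apply: sosD; apply: sosZ => //; nra.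
have YG : sum_of_squares (G - Y).
  by rewrite /Y opprB addrC subrK; apply: sosZ => //; exact: ltW.
pose b := Y ^+ k; pose a := G ^+ k.
have a0 : sum_of_squares a by exact: sosX.
have b0 : sum_of_squares b by exact: sosX.
have [U U0 abE] : exists2 U, sum_of_squares U & a - b = S * U.
  exists (c *: \sum_(i < k) G ^+ (k.-1 - i) * Y ^+ i).
    apply: sosZ; first exact: ltW.
    by apply: sos_sum => i _; apply: sosM; exact: sosX.
  rewrite /a /b subrXX opprB addrC subrK -scalerAl scalerAr.
  by [].
have ab0 : sum_of_squares (a - b) by rewrite abE; exact: sosM.
exists (k * M)%N; rewrite exprM -/a.
have bxa : b <=sos x ^+ k *: a.
  rewrite /b /a -exprZn; exact: sos_leX.
pose y := x ^+ k; have y0 : 0 <= y by rewrite exprn_ge0 // /x; lra.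
pose r := a ^+ M - (a - b) ^+ M.
have r0 : sum_of_squares r.
  by apply: sos_leX => //; rewrite opprB addrC subrK.
(* Bernoulli's inequality in the preorder of sums of squares. *)
have rle : r <=sos (M%:R * y) *: a ^+ M.
  rewrite /r; elim: {SMh MB0 M0 r r0 ksmall} M => [|M IH].
    by rewrite !expr0 subrr subr0 mul0r scale0r; exact: sos0.
  have -> : (M.+1%:R * y) *: a ^+ M.+1 - (a ^+ M.+1 - (a - b) ^+ M.+1) =
      a * ((M%:R * y) *: a ^+ M - (a ^+ M - (a - b) ^+ M)) +
      (y *: a - b) * (a - b) ^+ M + (y *: a) * (a ^+ M - (a - b) ^+ M).
    by rewrite !exprS -natr1 -!mul_mpolyC; ring.
  apply: sosD; first apply: sosD.
  - exact: sosM.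
  - by apply: sosM => //; exact: sosX.
  - by apply: sosM; [exact: sosZ|apply: sos_leX; rewrite // opprB addrC subrK].
have dMBy : M%:R * B' * y <= d.
  have : y * (M%:R * B' + 1) < d by rewrite -ltr_pdivlMr.
  nra.
have -> : a ^+ M * (h + d *: t) =
    U ^+ M * (S ^+ M * h) + r * (h + B *: t) +
    t * (B' *: ((M%:R * y) *: a ^+ M - r) + (d - M%:R * B' * y) *: a ^+ M +
         (B' - B) *: r).
  have -> : U ^+ M * (S ^+ M * h) = (a - b) ^+ M * h.
    by rewrite abE exprMn; ring.
  by rewrite /r -!mul_mpolyC; ring.
apply: sosD; first by apply: sosD; apply: sosM => //; exact: sosX.
apply: sosM => //; apply: sosD; first apply: sosD.
- exact: sosZ.
- by apply: sosZ; [rewrite subr_ge0|exact: sosX].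
- by apply: sosZ; rewrite // subr_ge0 le_max lexx.
Qed.
End SosOrder.

(** * Domination by powers of the sum of squares of the variables *)

Section Monomials.

Variable n : nat.
Implicit Types m : 'X_{1..n}.

Lemma mnm_ind_var (P : 'X_{1..n} -> Prop) :
  P 0%MM -> (forall i m, P m -> P (U_(i) + m)%MM) -> forall m, P m.
Proof.
move=> P0 PS m; have [k] := ubnP (mdeg m); elim: k m => // k IH m mk.
have [m0|m0] := eqVneq (mdeg m) 0%N.
  by move/eqP: m0; rewrite mdeg_eq0 => /eqP ->.
have [i mi] : exists i, m i != 0%N.
  apply/existsP; apply: contraR m0; rewrite negb_exists => /forallP m0.
  by rewrite mdegE big1 // => i _; have := m0 i; rewrite negbK => /eqP.
have mE : m = (U_(i) + (m - U_(i)))%MM.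
  by rewrite addmC submK // lep1mP.
rewrite mE; apply: PS; apply: IH; move: mk.
by rewrite {1}mE mdegD mdeg1 add1n ltnS.
Qed.

Lemma mnm_split m k l :
  mdeg m = (k + l)%N ->
  exists a b : 'X_{1..n}, [/\ m = (a + b)%MM, mdeg a = k & mdeg b = l].
Proof.
move: m k l; apply: mnm_ind_var => [k l|i m IH [|k] l].
- rewrite mdeg0; case: k l => [|k] [|l] // _.
  by exists 0%MM, 0%MM; rewrite addm0 mdeg0.
- by move=> ml; exists 0%MM, (U_(i) + m)%MM; rewrite add0m mdeg0 ml.
- rewrite mdegD mdeg1 add1n addSn => -[/IH[a [b [-> ak bl]]]].
  by exists (U_(i) + a)%MM, b; rewrite addmA mdegD mdeg1 ak.
Qed.

End Monomials.

Section CoefficientNorm.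

Variables (R : realType) (n : nat).
Implicit Types p q r : {mpoly R[n]}.

Definition sqnorm : {mpoly R[n]} := \sum_(i < n) 'X_i ^+ 2.

(** A bound [C] on the sum of the absolute values of the coefficients of a form
    of degree [d]. The list may contain repetitions and cancellations: this
    makes the bound visibly stable under sums and products by variables. *)
Definition l1_le (d : nat) (C : R) (p : {mpoly R[n]}) : Prop :=
  exists t : seq (R * 'X_{1..n}),
    [/\ all (fun cm => mdeg cm.2 == d) t,
        p = \sum_(cm <- t) cm.1 *: 'X_[cm.2]
      & \sum_(cm <- t) `|cm.1| <= C].

Lemma sqnormE (v : 'I_n -> R) : sqnorm.@[v] = \sum_i v i ^+ 2.
Proof.
rewrite raddf_sum /=; apply: eq_bigr => i _.
by rewrite rmorphXn /= mevalXU.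
Qed.

Lemma dhomog_sqnorm : sqnorm \is 2.-homog.
Proof.
by apply: rpred_sum => i _; rewrite mpolyXn dhomogX /= mdegMn mdeg1.
Qed.

Lemma sos_sqnorm k : sum_of_squares (sqnorm ^+ k).
Proof. by apply: sosX; apply: sos_sum => i _; exact: sos_sqr. Qed.

Lemma monomial_sqr_le_sqnorm (m : 'X_{1..n}) :
  'X_[m] ^+ 2 <=sos sqnorm ^+ mdeg m.
Proof.
elim/mnm_ind_var: m => [|i m IH].
  by rewrite mdeg0 mpolyX0 expr0 expr1n subrr; exact: sos0.
rewrite mdegD mdeg1 add1n exprS mpolyXD exprMn.
have -> : sqnorm * sqnorm ^+ mdeg m - 'X_i ^+ 2 * 'X_[m] ^+ 2 =
    sqnorm * (sqnorm ^+ mdeg m - 'X_[m] ^+ 2) +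
    (sqnorm - 'X_i ^+ 2) * 'X_[m] ^+ 2 by ring.
apply: sosD; apply: sosM => //.
- by rewrite -[sqnorm]expr1; exact: sos_sqnorm.
- rewrite /sqnorm (bigD1 i) //= addrC addrK.
  by apply: sos_sum => j _; exact: sos_sqr.
- exact: sos_sqr.
Qed.

(** The form [sqnorm ^+ k] is interior to the cone of sums of squares of degree
    [2 k]: it dominates every form of that degree, with a constant controlled by
    the coefficients. A monomial of degree [2 k] is a product [A * B] of two
    monomials of degree [k], and [A^2 + B^2 - 2 A B] and [A^2 + B^2 + 2 A B]
    are squares, while [A^2] and [B^2] are dominated by [sqnorm ^+ k]. *)
Lemma l1_le_sos k C p : l1_le (2 * k) C p -> p <=sos C *: sqnorm ^+ k.
Proof.
case=> t [/allP tk -> tC].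
have -> : C *: sqnorm ^+ k - \sum_(cm <- t) cm.1 *: 'X_[cm.2] =
    (C - \sum_(cm <- t) `|cm.1|) *: sqnorm ^+ k +
    \sum_(cm <- t) (`|cm.1| *: sqnorm ^+ k - cm.1 *: 'X_[cm.2]).
  by rewrite sumrB -scaler_suml scalerBl addrA subrK.
apply: sosD; first by apply: sosZ; rewrite ?subr_ge0 //; exact: sos_sqnorm.
rewrite big_seq; apply: sos_sum => -[c m] /tk /= /eqP.
rewrite mul2n -addnn => /mnm_split[a [b [-> ak bk]]].
rewrite mpolyXD.
set A := 'X_[a]; set B := 'X_[b].
have sosAB : sum_of_squares ((`|c| / 2) *: (sqnorm ^+ k - A ^+ 2) +
    (`|c| / 2) *: (sqnorm ^+ k - B ^+ 2)).
  apply: sosD; (apply: sosZ; first by rewrite divr_ge0).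
  - by rewrite -ak; exact: monomial_sqr_le_sqnorm.
  - by rewrite -bk; exact: monomial_sqr_le_sqnorm.
(* The sign of c decides which of A - B and A + B is squared. *)
pose e : R := if 0 <= c then 1 else -1.
have eE : `|c| = e * c /\ e * e = 1.
  rewrite /e; case: lerP => c0; split; rewrite ?mulr1 ?mulrNN ?mulN1r ?mul1r //.
    exact: ger0_norm.
  by rewrite ltr0_norm.
have -> : `|c| *: sqnorm ^+ k - c *: (A * B) =
    ((`|c| / 2) *: (sqnorm ^+ k - A ^+ 2) + (`|c| / 2) *: (sqnorm ^+ k - B ^+ 2)) +
    (`|c| / 2) *: (A - e *: B) ^+ 2.
  have -> : c *: (A * B) = (`|c| * e) *: (A * B).
    by rewrite eE.1 -mulrA mulrCA eE.2 mulr1.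
  have -> : B ^+ 2 = (e * e) *: B ^+ 2 by rewrite eE.2 scale1r.
  have cE : `|c| = `|c| / 2 + `|c| / 2 by lra.
  move: cE; set u := `|c| / 2 => ->.
  by rewrite -!mul_mpolyC; ring.
by apply: sosD => //; apply: sosZ; [rewrite divr_ge0|exact: sos_sqr].
Qed.

Lemma l1_le_weaken d C C' p : C <= C' -> l1_le d C p -> l1_le d C' p.
Proof. by move=> CC' [t [td pE tC]]; exists t; split=> //; exact: le_trans CC'. Qed.

Lemma l1_le0 d : l1_le d 0 0.
Proof. by exists [::]; rewrite !big_nil. Qed.

Lemma l1_leD d C C' p q : l1_le d C p -> l1_le d C' q -> l1_le d (C + C') (p + q).
Proof.
move=> [s [sd -> sC]] [t [td -> tC]]; exists (s ++ t).
by rewrite all_cat sd td !big_cat lerD.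
Qed.

Lemma l1_leZ d C c p : l1_le d C p -> l1_le d (`|c| * C) (c *: p).
Proof.
move=> [s [sd -> sC]]; exists [seq (c * cm.1, cm.2) | cm <- s].
rewrite all_map scaler_sumr !big_map; split=> //.
  by apply: eq_bigr => cm _; rewrite scalerA.
by under eq_bigr do rewrite normrM; rewrite -mulr_sumr ler_wpM2l.
Qed.

Lemma l1_leX d C i p : l1_le d C p -> l1_le d.+1 C ('X_i * p).
Proof.
move=> [s [sd -> sC]]; exists [seq (cm.1, (U_(i) + cm.2)%MM) | cm <- s].
rewrite all_map mulr_sumr !big_map; split=> //.
  by apply: sub_all sd => cm /eqP /= <-; rewrite mdegD mdeg1.
by apply: eq_bigr => cm _; rewrite mpolyXD -scalerAr.
Qed.

Lemma l1_le_sum d (C : 'I_n -> R) (F : 'I_n -> {mpoly R[n]}) :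
  (forall i, l1_le d (C i) (F i)) -> l1_le d (\sum_i C i) (\sum_i F i).
Proof.
move=> FC; elim/big_ind2: _ => //; first exact: l1_le0.
by move=> *; exact: l1_leD.
Qed.

Lemma l1_le_sqnorm d C p : l1_le d C p -> l1_le d.+2 (n%:R * C) (sqnorm * p).
Proof.
move=> pC; rewrite mulr_suml.
have -> : n%:R * C = \sum_(i < n) C by rewrite sumr_const card_ord mulr_natl.
by apply: l1_le_sum => i; rewrite expr2 -mulrA; do 2!apply: l1_leX.
Qed.

Lemma l1_le_dhomog d p : p \is d.-homog -> exists C, l1_le d C p.
Proof.
move=> /dhomogP pd; exists (\sum_(m <- msupp p) `|p@_m|).
exists [seq (p@_m, m) | m <- msupp p]; split.
- by apply/allP => _ /mapP[m /pd /= md ->] /=; rewrite md.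
- by rewrite big_map; exact: mpolyE.
- by rewrite big_map.
Qed.

End CoefficientNorm.

(** * Gaussian averages of powers of a linear form *)

Section Polarization.

Variables (R : realType) (n : nat).
Implicit Types (p : {mpoly R[n]}) (m : 'X_{1..n}) (M : 'X_{1..n} -> R).

(** If [M] is the moment functional of a random vector [u], then [polar M j m] is
    the expectation of [u^m * (u . X)^j], a form of degree [j] in the variables
    [X]. Expanding one factor [u . X] at a time gives the recursion, which makes
    sense for any function [M] on monomials. *)
Fixpoint polar M (j : nat) m : {mpoly R[n]} :=
  if j is j'.+1 then \sum_i 'X_i * polar M j' (U_(i) + m)%MM else (M m)%:MP.

Lemma polarS M j m : polar M j.+1 m = \sum_i 'X_i * polar M j (U_(i) + m)%MM.
Proof. by []. Qed.

(** Each of the [n^j] products of variables in the expansion of [(u . X)^j]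
    carries an error of at most [e]. *)
Lemma polar_approx M M' (D : nat) (e : R) :
  (forall m, (mdeg m <= D)%N -> `|M m - M' m| <= e) ->
  forall j m, (j + mdeg m <= D)%N ->
    l1_le j (n%:R ^+ j * e) (polar M j m - polar M' j m).
Proof.
move=> MM'; elim=> [|j IH] m jD /=.
  exists [:: (M m - M' m, 0%MM)]; rewrite !big_seq1 /= mdeg0 expr0 mul1r.
  by rewrite mpolyX0 -mul_mpolyC mulr1 mpolyCB MM'.
rewrite -sumrB.
have -> : n%:R ^+ j.+1 * e = \sum_(i < n) (n%:R ^+ j * e).
  by rewrite sumr_const card_ord exprS -mulrA mulr_natl.
apply: l1_le_sum => i; rewrite -mulrBr; apply: l1_leX; apply: IH.
by rewrite mdegD mdeg1 addnA addn1.
Qed.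

(** This is where sums of squares come from: for even [j] the powers on the right
    are squares, and replacing [u^m] with a nonnegative polynomial in [u] makes
    all their coefficients nonnegative. *)
Lemma polar_eval (T : finType) (w : T -> R) (u : T -> 'I_n -> R) j m :
  polar (fun m => \sum_a w a * 'X_[m].@[u a]) j m =
  \sum_a (w a * 'X_[m].@[u a]) *: (\sum_i u a i *: 'X_i) ^+ j.
Proof.
elim: j m => [|j IH] m /=.
  rewrite raddf_sum /=; apply: eq_bigr => a _.
  by rewrite expr0 -mul_mpolyC mulr1.
under eq_bigr do rewrite IH mulr_sumr.
rewrite exchange_big; apply: eq_bigr => a _ /=.
rewrite exprS mulr_suml scaler_sumr; apply: eq_bigr => i _.
rewrite mpolyXD mevalM mevalXU -!mul_mpolyC; ring.
Qed.

(** Moments of the standard normal law: the double factorials at even orders. *)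
Fixpoint gauss_moment (j : nat) : nat :=
  match j with 0 => 1 | 1 => 0 | j'.+2 => j'.+1 * gauss_moment j' end.

Lemma gauss_momentS j : gauss_moment j.+1 = (j * gauss_moment j.-1)%N.
Proof. by case: j. Qed.

(** Moments of the standard normal vector, whose coordinates are independent. *)
Definition gauss m : R := \prod_i (gauss_moment (m i))%:R.

Lemma gauss_ibp i m :
  gauss (U_(i) + m)%MM = (m i)%:R * gauss (m - U_(i))%MM.
Proof.
rewrite /gauss (bigD1 i) //= [in RHS](bigD1 i) //= mulrA.
congr (_ * _).
  by rewrite mnmDE mnmBE mnm1E eqxx add1n subn1 gauss_momentS natrM.
apply: eq_bigr => k ki.
by rewrite mnmDE mnmBE mnm1E eq_sym (negPf ki) add0n subn0.
Qed.

(** Gaussian integration by parts, [E(u_i F(u)) = E(d_i F(u))], for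
    [F(u) = u^m (u . X)^j]. *)
Lemma polar_gauss_ibp i j m :
  polar gauss j (U_(i) + m)%MM =
  (m i)%:R *: polar gauss j (m - U_(i))%MM +
  j%:R *: ('X_i * polar gauss j.-1 m).
Proof.
elim: j m => [|j IH] m.
  by rewrite /= scale0r addr0 gauss_ibp -mul_mpolyC -mpolyCM.
rewrite !polarS.
have -> : \sum_k 'X_k * polar gauss j (U_(k) + (U_(i) + m))%MM =
    \sum_k (if k == i then 'X_i * polar gauss j m else 0) +
    (m i)%:R *: (\sum_k 'X_k * polar gauss j (U_(k) + (m - U_(i)))%MM) +
    j%:R *: ('X_i * \sum_k 'X_k * polar gauss j.-1 (U_(k) + m)%MM).
  rewrite mulr_sumr !scaler_sumr -!big_split /=; apply: eq_bigr => k _.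
  have -> : (U_(k) + (U_(i) + m) = U_(i) + (U_(k) + m))%MM.
    by rewrite addmA [(U_(k) + U_(i))%MM]addmC -addmA.
  rewrite IH mnmDE mnm1E natrD scalerDl.
  have -> : (m i)%:R *: polar gauss j (U_(k) + m - U_(i))%MM =
      (m i)%:R *: polar gauss j (U_(k) + (m - U_(i)))%MM.
    have [->|mi] := eqVneq (m i) 0%N; first by rewrite !scale0r.
    congr (_ *: polar _ _ _); rewrite -{1}(@submK _ U_(i)%MM m) ?lep1mP //.
    by rewrite addmA addmK.
  have -> : (k == i)%:R *: polar gauss j (U_(k) + m - U_(i))%MM =
      if k == i then polar gauss j m else 0.
    case: eqP => [->|_]; last by rewrite scale0r.
    by rewrite scale1r addmC addmK.
  case: eqP => [->|_]; rewrite -!mul_mpolyC; ring.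
rewrite -big_mkcond big_pred1_eq /= -polarS.
have -> : j%:R *: ('X_i * \sum_k 'X_k * polar gauss j.-1 (U_(k) + m)%MM) =
    j%:R *: ('X_i * polar gauss j m).
  by case: j {IH} => [|j]; rewrite ?scale0r.
by rewrite -[j.+1%:R]natr1 -!mul_mpolyC; ring.
Qed.

(** The leading constant of the expectation of [u^m (u . X)^(r + 2 l)] for a
    monomial of degree [r]: the product of the falling factorial of length [r] of
    [r + 2 l], coming from the factors [u . X] that are differentiated, by the
    moment of order [2 l]. *)
Definition polar_const (r l : nat) : R := (r + 2 * l)`!%:R / (2 ^ l * l`!)%:R.

Lemma polar_const_gt0 r l : 0 < polar_const r l.
Proof. by rewrite divr_gt0 // ltr0n ?fact_gt0 // muln_gt0 expn_gt0 fact_gt0. Qed.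

Lemma polar_constS r l : polar_const r.+1 l = (r + 2 * l).+1%:R * polar_const r l.
Proof. by rewrite /polar_const addSn factS natrM mulrA. Qed.

Lemma polar_const_shift r l :
  polar_const r l.+1 = polar_const r.+2 l / (2 * l.+1%:R).
Proof.
rewrite /polar_const; have -> : (r + 2 * l.+1 = r.+2 + 2 * l)%N by lia.
rewrite -mulrA -invfM -natrM -natrM; congr (_ / _%:R).
by rewrite expnS factS; lia.
Qed.

Lemma polar_gauss0 l :
  polar gauss (2 * l) 0%MM = polar_const 0 l *: sqnorm R n ^+ l.
Proof.
elim: l => [|l IH].
  rewrite /polar_const muln0 addn0 /= /gauss big1; last by move=> i _; rewrite mnm0E.
  by rewrite expr0 fact0 expn0 muln1 divr1 scale1r.
have -> : (2 * l.+1 = (2 * l).+2)%N by lia.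
rewrite polarS; under eq_bigr do rewrite polar_gauss_ibp mnm0E scale0r add0r /= IH.
have -> : polar_const 0 l.+1 = (2 * l).+1%:R * polar_const 0 l.
  rewrite polar_const_shift !polar_constS add0n.
  have -> : (1 + 2 * l).+1%:R = 2 * l.+1%:R :> R by rewrite -natrM; congr _%:R; lia.
  by rewrite mulrAC divff ?mul1r // mulf_neq0 // pnatr_eq0.
rewrite exprS {2}/sqnorm mulr_suml scaler_sumr; apply: eq_bigr => i _.
by rewrite -!mul_mpolyC; ring.
Qed.

(** By rotation invariance, weighting [(u . X)^j] by a polynomial [q(u)] and
    averaging over the Gaussian vector [u] gives, for large [j], almost
    [q(X)] times a power of [sqnorm]. In the integration by parts formula for
    [U_(i) + m], the term with a derivative of [u^m] has two degrees less in
    [u]; compared with the main term its constant is smaller by a factor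
    [2 (l + 1)]. *)
Lemma polar_gauss_asymptotic m :
  exists2 C : R, 0 <= C & forall l, exists2 p,
    l1_le (mdeg m) (C / l.+1%:R) p &
    polar gauss (mdeg m + 2 * l) m =
      polar_const (mdeg m) l *: (sqnorm R n ^+ l * ('X_[m] + p)).
Proof.
have [k] := ubnP (mdeg m); elim: k m => // k IH m.
elim/mnm_ind_var: m => [_|i m _].
  exists 0 => // l; exists 0; first by rewrite mul0r; exact: l1_le0.
  by rewrite mdeg0 add0n polar_gauss0 mpolyX0 addr0 mulr1.
rewrite mdegD mdeg1 add1n ltnS => mk.
have [C C0 Cp] := IH m mk.
have [mi|mi] := eqVneq (m i) 0%N.
  exists C => // l; have [p pC pE] := Cp l; exists ('X_i * p).
    exact: l1_leX.
  rewrite addSn polar_gauss_ibp mi scale0r add0r /= pE polar_constS mpolyXD.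
  by rewrite -!mul_mpolyC; ring.
pose m' := (m - U_(i))%MM.
have mE : m = (U_(i) + m')%MM by rewrite addmC submK // lep1mP.
have mdE : mdeg m = (mdeg m').+1 by rewrite {1}mE mdegD mdeg1.
have [C' C'0 C'p] : exists2 C : R, 0 <= C & forall l, exists2 p,
    l1_le (mdeg m') (C / l.+1%:R) p &
    polar gauss (mdeg m' + 2 * l) m' =
      polar_const (mdeg m') l *: (sqnorm R n ^+ l * ('X_[m'] + p)).
  by apply: IH; apply: leq_ltn_trans mk; rewrite mdE.
exists (C + (m i)%:R * (n%:R * (1 + C'))) => [|l].
  by rewrite addr_ge0 // !mulr_ge0 // addr_ge0.
have [p pC pE] := Cp l; have [p' p'C p'E] := C'p l.+1.
(* The ratio of the constants of the derivative term and of the main term. *)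
pose c : R := (m i)%:R / (2 * l.+1%:R).
exists ('X_i * p + c *: (sqnorm R n * ('X_[m'] + p'))).
  apply: (@l1_le_weaken _ _ _ (C / l.+1%:R + `|c| * (n%:R * (1 + C' / l.+2%:R)))).
    have C'l : C' / l.+2%:R <= C'.
      by rewrite ler_piMr // invf_le1 ?ler1n ?ltr0n.
    have C'l0 : 0 <= C' / l.+2%:R by rewrite divr_ge0.
    rewrite ger0_norm; last by rewrite divr_ge0 // mulr_ge0.
    rewrite -subr_ge0.
    have -> : (C + (m i)%:R * (n%:R * (1 + C'))) / l.+1%:R -
        (C / l.+1%:R + c * (n%:R * (1 + C' / l.+2%:R))) =
        (m i)%:R * n%:R / l.+1%:R * (1 + C' - (1 + C' / l.+2%:R) / 2).
      have : l.+1%:R != 0 :> R by rewrite pnatr_eq0.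
      by rewrite /c; move: (C' / l.+2%:R) (l.+1%:R) => x y y0; field.
    apply: mulr_ge0; first by rewrite divr_ge0 // mulr_ge0.
    by move: (C' / _) C'l C'l0 => x; lra.
  apply: l1_leD; first exact: l1_leX.
  rewrite mdE; apply: l1_leZ; apply: l1_le_sqnorm; apply: l1_leD => //.
  by exists [:: (1, m')]; rewrite !big_seq1 /= scale1r normr1 eqxx.
rewrite addSn polar_gauss_ibp succnK -/m' pE polar_constS mpolyXD.
have dE : ((mdeg m + 2 * l).+1 = mdeg m' + 2 * l.+1)%N by lia.
rewrite [in polar _ _ m']dE p'E polar_const_shift -mdE polar_constS /c.
move: (2 * l.+1%:R)^-1 => x.
move: (_.+1%:R) ((m i)%:R) (polar_const _ _) => y z t.
rewrite exprS -!mul_mpolyC; ring.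
Qed.

End Polarization.

(** * Moments of the simple random walk *)

Section SimpleRandomWalk.

Variable R : realType.
Implicit Types (f g : R -> R) (N p : nat).

Definition step_avg f (t : R) : R := (f (t + 1) + f (t - 1)) / 2.
Definition step_diff f (t : R) : R := (f (t + 1) - f (t - 1)) / 2.

(** The expectation of [f] at the position, after [N] steps, of the simple
    symmetric random walk on the integers started at [0]. *)
Definition walk N f : R := iter N step_avg f 0.

Lemma walkS N f : walk N.+1 f = walk N (step_avg f).
Proof. by rewrite /walk iterSr. Qed.

Lemma eq_walk N f g : f =1 g -> walk N f = walk N g.
Proof.
elim: N f g => [|N IH] f g fg; first exact: fg.
by rewrite !walkS; apply: IH => t; rewrite /step_avg !fg.
Qed.

Lemma walk_le N f g : (forall t, f t <= g t) -> walk N f <= walk N g.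
Proof.
elim: N f g => [|N IH] f g fg; first exact: fg.
rewrite !walkS; apply: IH => t; rewrite /step_avg.
by have := fg (t + 1); have := fg (t - 1); lra.
Qed.

Lemma walkD N f g : walk N (fun t => f t + g t) = walk N f + walk N g.
Proof.
elim: N f g => [//|N IH] f g; rewrite !walkS -IH; apply: eq_walk => t.
by rewrite /step_avg; lra.
Qed.

Lemma walkZ N (c : R) f : walk N (fun t => c * f t) = c * walk N f.
Proof.
elim: N f => [//|N IH] f; rewrite !walkS -IH; apply: eq_walk => t.
by rewrite /step_avg; ring.
Qed.

Lemma walk_odd N f : (forall t, f (- t) = - f t) -> walk N f = 0.
Proof.
elim: N f => [|N IH] f fodd.
  by have := fodd 0; rewrite /walk /= oppr0; lra.
rewrite walkS; apply: IH => t; rewrite /step_avg.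
have -> : - t + 1 = - (t - 1) by ring.
have -> : - t - 1 = - (t + 1) by ring.
by rewrite !fodd; lra.
Qed.

(** Stein's identity for the random walk: by exchangeability of the steps, [t]
    may be replaced with [N] times the last step, over which the average is a
    difference. It is the discrete form of Gaussian integration by parts. *)
Lemma walk_stein N f :
  walk N (fun t => t * f t) = N%:R * walk N.-1 (step_diff f).
Proof.
elim: N f => [|N IH] f; first by rewrite /walk /= !mul0r.
rewrite walkS (@eq_walk _ _ (fun t => t * step_avg f t + step_diff f t)); last first.
  by move=> t; rewrite /step_avg /step_diff; lra.
rewrite walkD IH /= -natr1 mulrDl mul1r; congr (_ + _).
case: N {IH} => [|N]; first by rewrite !mul0r.
rewrite walkS; congr (_ * _); apply: eq_walk => t.
rewrite /step_avg /step_diff (_ : t - 1 + 1 = t + 1 - 1); last by ring.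
by lra.
Qed.

Lemma walk_finite N : exists (T : finType) (w u : T -> R),
  (forall a, 0 <= w a) /\ forall f, walk N f = \sum_a w a * f (u a).
Proof.
elim: N => [|N [T [w [u [w0 wE]]]]].
  exists unit, (fun=> 1), (fun=> 0); split=> // f.
  by rewrite big_const card_unit /= addr0 mul1r.
exists (T + T)%type, (fun a => match a with inl b | inr b => w b / 2 end),
  (fun a => match a with inl b => u b + 1 | inr b => u b - 1 end).
split=> [[a|a]|f]; rewrite ?divr_ge0 //.
rewrite walkS wE big_sumType /= -big_split /=; apply: eq_bigr => a _.
by rewrite /step_avg; lra.
Qed.

(** The three estimates are proved together: from one even power to the next,
    [step_avg] and [t * step_diff] are transformed linearly, with nonnegative
    coefficients [t^2 + 1], [2] and [2 t^2]. *)
Lemma step_even_power p (t : R) :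
  [/\ t ^+ (2 * p) <= step_avg (fun t => t ^+ (2 * p)) t,
      (2 * p)%:R * t ^+ (2 * p) <= t * step_diff (fun t => t ^+ (2 * p)) t
    & t * step_diff (fun t => t ^+ (2 * p)) t <=
        (2 * p)%:R * step_avg (fun t => t ^+ (2 * p)) t].
Proof.
rewrite /step_avg /step_diff; elim: p => [|p].
  by rewrite muln0 !expr0 !mul0r; split; lra.
have -> : (2 * p.+1 = (2 * p).+2)%N by lia.
rewrite !exprS.
have : 0 <= t ^+ (2 * p) by rewrite exprM exprn_ge0 // sqr_ge0.
have : 0 <= (2 * p)%:R :> R by [].
have -> : (2 * p).+2%:R = (2 * p)%:R + 2 :> R by rewrite -addn2 natrD.
move: ((t + 1) ^+ _) ((t - 1) ^+ _) (t ^+ _) ((2 * p)%:R) => x y z k k0 z0.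
set A := (x + y) / 2; set D := (x - y) / 2 => -[h1 h2 h3].
have A0 : 0 <= A by lra.
have tD0 : 0 <= t * D by nra.
have -> : ((t + 1) * ((t + 1) * x) + (t - 1) * ((t - 1) * y)) / 2 =
  (t ^+ 2 + 1) * A + 2 * (t * D) by rewrite /A /D; field.
have -> : t * (((t + 1) * ((t + 1) * x) - (t - 1) * ((t - 1) * y)) / 2) =
  (t ^+ 2 + 1) * (t * D) + 2 * t ^+ 2 * A by rewrite /A /D; field.
move: (t * D) tD0 h2 h3 => E E0 h2 h3.
have -> : t * (t * z) = t ^+ 2 * z by ring.
have t0 := sqr_ge0 t.
split; nra.
Qed.

Lemma step_diff_odd_power p (t : R) :
  (2 * p).+1%:R * t ^+ (2 * p) <= step_diff (fun t => t ^+ (2 * p).+1) t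
    <= (2 * p).+1%:R * step_avg (fun t => t ^+ (2 * p)) t.
Proof.
have [] := step_even_power p t; rewrite /step_avg /step_diff !exprS -(natr1 (2 * p)).
by move: ((t + 1) ^+ _) ((t - 1) ^+ _) (t ^+ _) ((2 * p)%:R) => x y z k *; nra.
Qed.

(** The even moments of the walk are at most those of the normal law of the same
    variance: by convexity the difference in Stein's identity is at most the
    average of the derivative. *)
Lemma walk_moment_upper N p :
  walk N (fun t => t ^+ (2 * p)) <= (gauss_moment (2 * p))%:R * N%:R ^+ p.
Proof.
elim: p => [|p IH].
  rewrite muln0 mulr1; elim: N => [|N IH]; first by rewrite /walk /= expr0.
  rewrite walkS; apply: le_trans IH; apply: walk_le => t.
  by rewrite /step_avg !expr0; lra.
have -> : (2 * p.+1 = (2 * p).+2)%N by lia.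
rewrite (@eq_walk _ _ (fun t => t * t ^+ (2 * p).+1)); last by move=> t; rewrite exprS.
rewrite walk_stein gauss_momentS natrM exprS.
have : walk N.-1 (step_diff (fun t => t ^+ (2 * p).+1)) <=
    (2 * p).+1%:R * walk N.-1 (step_avg (fun t => t ^+ (2 * p))).
  by rewrite -walkZ; apply: walk_le => t; case/andP: (step_diff_odd_power p t).
case: N IH => [|N]; first by rewrite !mul0r mulr0.
rewrite -walkS /= => IH h.
rewrite mulrCA ler_pM2l ?ltr0n // -mulrA; apply: le_trans h _.
by rewrite ler_pM2l ?ltr0n.
Qed.

(** The difference in Stein's identity is at least the derivative at the middle
    point; [N] decreases by one at each use, whence the falling factorial. *)
Lemma walk_moment_lower N p :
  (gauss_moment (2 * p))%:R * (N ^_ p)%:R <= walk N (fun t => t ^+ (2 * p)).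
Proof.
elim: p N => [|p IH] N.
  rewrite muln0 ffactn0 mulr1; elim: N => [|N IH]; first by rewrite /walk /= expr0.
  rewrite walkS; apply: le_trans IH _; apply: walk_le => t.
  by rewrite /step_avg !expr0; lra.
have -> : (2 * p.+1 = (2 * p).+2)%N by lia.
rewrite (@eq_walk _ _ (fun t => t * t ^+ (2 * p).+1)); last by move=> t; rewrite exprS.
rewrite walk_stein gauss_momentS natrM ffactnS natrM.
rewrite mulrCA ler_wpM2l // -mulrA /=.
apply: (@le_trans _ _ ((2 * p).+1%:R * walk N.-1 (fun t => t ^+ (2 * p)))).
  by rewrite ler_wpM2l.
by rewrite -walkZ; apply: walk_le => t; case/andP: (step_diff_odd_power p t).
Qed.

End SimpleRandomWalk.

(** * Discrete approximation of the Gaussian moments *)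

Section GaussApproximation.

Variable R : realType.

(** The product of the factors [1 - i / N] for [i < p] is at least
    [1 - p^2 / N]; denominators are cleared. *)
Lemma ffact_lower (N p : nat) :
  (N%:R - (p ^ 2)%:R) * N%:R ^+ p <= N%:R * (N ^_ p)%:R :> R.
Proof.
elim: p => [|p IH]; first by rewrite expr0 ffactn0 subr0.
have [pN|Np] := leqP p N; last first.
  rewrite ffact_small; last exact: leqW.
  rewrite mulr0 mulr_le0_ge0 ?exprn_ge0 // subr_le0 ler_nat.
  by rewrite expnS expn1; nia.
rewrite ffactnSr natrM natrB // exprS.
have pN' : p%:R <= N%:R :> R by rewrite ler_nat.
have p0 : 0 <= p%:R :> R by [].
have X0 : 0 <= N%:R ^+ p :> R by rewrite exprn_ge0.
move: IH; rewrite !natrX -(natr1 p).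
move: (N%:R) (p%:R) ((N ^_ p)%:R) (N%:R ^+ p) pN' p0 X0 => a b F X ba b0 X0 h.
have h1 : (a - b ^+ 2) * X * (a - b) <= a * F * (a - b) by rewrite ler_wpM2r // subr_ge0.
rewrite [leRHS]mulrA; apply: le_trans h1; rewrite -subr_ge0.
have -> : (a - b ^+ 2) * X * (a - b) - (a - (b + 1) ^+ 2) * (a * X) =
  (a * (b + 1) + b ^+ 3) * X by ring.
by apply: mulr_ge0 => //; apply: addr_ge0; rewrite ?exprn_ge0 ?mulr_ge0 //; lra.
Qed.

Lemma gauss_moment_odd j : odd j -> gauss_moment j = 0%N.
Proof.
have [k] := ubnP j; elim: k j => // k IH [|[|j]] //= jk; rewrite negbK => oj.
by rewrite IH ?muln0 //; lia.
Qed.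

Lemma gauss_moment_le_fact j : (gauss_moment j <= j`!)%N.
Proof.
have [k] := ubnP j; elim: k j => // k IH [|[|j]] //= jk.
rewrite !factS; apply: leq_trans (leq_pmull _ _) => //.
by rewrite leq_mul2l IH //; lia.
Qed.

Lemma walk_moment_scaled (K D j : nat) :
  (0 < K)%N -> (j <= D)%N ->
  (1 - (D ^ 2)%:R / (K ^ 2)%:R) * (gauss_moment j)%:R
    <= walk (K ^ 2) (fun t : R => (t / K%:R) ^+ j) <= (gauss_moment j)%:R.
Proof.
move=> K0 jD; have [oj|ej] := boolP (odd j).
  rewrite gauss_moment_odd // mulr0 walk_odd ?lexx // => t.
  by rewrite mulNr exprNn -signr_odd oj expr1 mulN1r.
have -> : j = (2 * j./2)%N by rewrite mul2n -[LHS]odd_double_half (negPf ej).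
set p := j./2.
have pD : (p <= D)%N by rewrite /p; lia.
have K0' : 0 < (K ^ 2)%:R ^+ p :> R by rewrite exprn_gt0 // ltr0n expn_gt0 K0.
have -> : walk (K ^ 2) (fun t : R => (t / K%:R) ^+ (2 * p)) =
    walk (K ^ 2) (fun t => t ^+ (2 * p)) / (K ^ 2)%:R ^+ p.
  rewrite mulrC -walkZ; apply: eq_walk => t.
  by rewrite expr_div_n mulrC natrX -exprM.
rewrite ler_pdivlMr // ler_pdivrMr // walk_moment_upper andbT.
apply: le_trans (walk_moment_lower _ _ _).
rewrite mulrAC mulrC ler_wpM2l //.
have N0 : 0 < (K ^ 2)%:R :> R by rewrite ltr0n expn_gt0 K0.
rewrite -(ler_pM2l N0) mulrA mulrBr mulr1 mulrCA divff ?gt_eqF // mulr1.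
apply: le_trans (ffact_lower _ _); rewrite ler_wpM2r ?exprn_ge0 //.
by rewrite lerD2l lerN2 ler_nat leq_sqr.
Qed.

(** The Gaussian moments of bounded order are limits of moments of finitely
    supported measures: the law of [n] independent random walks of [K^2] steps,
    rescaled by [K]. *)
Lemma gauss_approx (n D : nat) (e : R) : 0 < e ->
  exists (T : finType) (w : T -> R) (u : T -> 'I_n -> R),
    (forall a, 0 <= w a) /\
    forall m : 'X_{1..n}, (mdeg m <= D)%N ->
      `|\sum_a w a * 'X_[m].@[u a] - gauss R m| <= e.
Proof.
move=> e0.
pose B : R := (n * D ^ 2 * D`! ^ n)%:R.
(* The relative error of the product of n moments is at most n D^2 / K^2. *)
pose K := (Num.bound (B / e) + D).+1.
have K0 : (0 < K)%N by [].
have KB : B / (K ^ 2)%:R <= e.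
  rewrite ler_pdivrMr ?ltr0n ?expn_gt0 // mulrC -ler_pdivrMr //.
  apply: (@le_trans _ _ (Num.bound (B / e))%:R).
    by apply: ltW; apply: archi_boundP; rewrite divr_ge0 // ltW.
  by rewrite ler_nat /K expnS expn1; nia.
have [T [w [u [w0 wE]]]] := walk_finite R (K ^ 2).
exists {ffun 'I_n -> T}, (fun a : {ffun 'I_n -> T} => \prod_i w (a i)),
  (fun (a : {ffun 'I_n -> T}) i => u (a i) / K%:R).
split=> [a|m mD]; first exact: prodr_ge0.
pose x j := walk (K ^ 2) (fun t : R => (t / K%:R) ^+ j).
have -> : \sum_(a : {ffun 'I_n -> T}) (\prod_i w (a i)) *
    'X_[m].@[fun i => u (a i) / K%:R] = \prod_i x (m i).
  rewrite /x; under [RHS]eq_bigr do rewrite wE.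
  rewrite bigA_distr_bigA; apply: eq_bigr => a _.
  by rewrite mevalX -big_split.
pose th : R := 1 - (D ^ 2)%:R / (K ^ 2)%:R.
have th01 : 0 <= th <= 1.
  rewrite /th subr_ge0 lerBlDr lerDl divr_ge0 // andbT.
  by rewrite ler_pdivrMr ?mul1r ?ler_nat ?leq_sqr ?ltr0n ?expn_gt0 // /K; lia.
have mi i : (m i <= D)%N.
  by apply: leq_trans mD; rewrite mdegE (bigD1 i) //= leq_addr.
have xm i : th * (gauss_moment (m i))%:R <= x (m i) <= (gauss_moment (m i))%:R.
  exact: walk_moment_scaled.
have gm : gauss R m <= (D`! ^ n)%:R.
  rewrite natrX -[n in _ ^+ n]card_ord -prodr_const; apply: ler_prod => i _.
  rewrite ler0n ler_nat; apply: leq_trans (gauss_moment_le_fact _) _.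
  exact: leq_fact.
have g0 : 0 <= gauss R m by exact: prodr_ge0.
have up : \prod_i x (m i) <= gauss R m.
  apply: ler_prod => i _; case/andP: (xm i) => lo ->; rewrite andbT.
  by apply: le_trans lo; rewrite mulr_ge0 //; case/andP: th01.
have lo : th ^+ n * gauss R m <= \prod_i x (m i).
  rewrite -[n in _ ^+ n]card_ord -prodr_const -big_split /=.
  apply: ler_prod => i _; case/andP: (xm i) => -> _; rewrite andbT.
  by rewrite mulr_ge0 //; case/andP: th01.
rewrite ler0_norm ?subr_le0 // opprB; apply: le_trans KB.
have thn : 1 + n%:R * - ((D ^ 2)%:R / (K ^ 2)%:R) <= th ^+ n.
  by apply: bernoulli; case/andP: th01; rewrite /th; lra.
have -> : B / (K ^ 2)%:R = n%:R * ((D ^ 2)%:R / (K ^ 2)%:R) * (D`! ^ n)%:R.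
  by rewrite /B !natrM; ring.
apply: le_trans (_ : (1 - th ^+ n) * gauss R m <= _); first by lra.
case/andP: th01 => th0 th1.
have thn1 : th ^+ n <= 1 by rewrite exprn_ile1.
apply: ler_pM => //; lra.
Qed.

End GaussApproximation.

(** * Reznick's theorem *)

Section PositiveDefiniteForms.

Variables (R : realType) (n : nat).
Implicit Types (h p q : {mpoly R[n]}).

Lemma const_mx1_neq0 : (0 < n)%N -> (const_mx 1 : 'rV[R]_n) != 0.
Proof.
move=> n0; apply/eqP => /rowP /(_ (Ordinal n0)); rewrite !mxE => /eqP.
by rewrite oner_eq0.
Qed.

Lemma sqnorm_gt0 (x : 'rV[R]_n) : x != 0 -> 0 < (sqnorm R n).@[x ord0].
Proof.
move=> x0; rewrite lt_def sqnormE sumr_ge0 ?andbT => [|i _]; last exact: sqr_ge0.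
apply: contraNneq x0 => /eqP; rewrite psumr_eq0 => [/allP xi|i _]; last exact: sqr_ge0.
apply/eqP/rowP => i; rewrite mxE; apply/eqP.
by rewrite -sqrf_eq0; apply: xi; rewrite mem_index_enum.
Qed.

Lemma dhomog_meval d p (c : R) (x : 'rV[R]_n) :
  p \is d.-homog -> p.@[(c *: x) ord0] = c ^+ d * p.@[x ord0].
Proof.
move=> /dhomogP pd; rewrite !mevalE mulr_sumr big_seq [RHS]big_seq.
apply: eq_bigr => m /pd /= md; rewrite mulrCA; congr (_ * _).
rewrite -md mdegE -prodrXr -big_split; apply: eq_bigr => i _.
by rewrite mxE exprMn.
Qed.

Lemma positive_definite_even d p :
  (0 < n)%N -> p \is d.-homog -> positive_definite p -> ~~ odd d.
Proof.
move=> n0 pd p0; apply/negP => od.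
have x0 := const_mx1_neq0 n0; set x := const_mx _ in x0.
have := p0 _ x0; have := p0 (- x); rewrite oppr_eq0 => /(_ x0).
by rewrite -scaleN1r (dhomog_meval _ _ pd) -signr_odd od expr1; lra.
Qed.

(** By homogeneity it is enough to know the minimum on the unit sphere. *)
Lemma positive_definite_lower k p :
  (0 < n)%N -> p \is (2 * k).-homog -> positive_definite p ->
  exists2 e : R, 0 < e & forall x : 'rV[R]_n,
    e * (sqnorm R n).@[x ord0] ^+ k <= p.@[x ord0].
Proof.
move=> n0 pk p0.
pose t := [seq (p@_m, m : 'I_n -> nat) | m <- msupp p].
have tE (x : 'rV[R]_n) :
    \sum_(cm <- t) cm.1 * \prod_i x ord0 i ^+ cm.2 i = p.@[x ord0].
  by rewrite big_map mevalE.
have [|e e0 eP] := @polynomial_sphere_min R n t.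
  by move=> x /p0; rewrite tE.
exists e => // x.
have low (y : 'rV[R]_n) : y != 0 ->
    e * (sqnorm R n).@[y ord0] ^+ k <= p.@[y ord0].
  move=> y0; set s := (sqnorm R n).@[_].
  have sE : s = \sum_i y ord0 i ^+ 2 by exact: sqnormE.
  have s0 : 0 < s by exact: sqnorm_gt0.
  have r0 : Num.sqrt s != 0 by rewrite gt_eqF // sqrtr_gt0.
  have yE : y = Num.sqrt s *: ((Num.sqrt s)^-1 *: y).
    by rewrite scalerA divff // scale1r.
  rewrite yE (dhomog_meval _ _ pk) exprM sqr_sqrtr ?(ltW s0) // mulrC.
  rewrite ler_pM2l ?exprn_gt0 // -tE; apply: eP.
  under eq_bigr do rewrite mxE exprMn.
  by rewrite -mulr_sumr -sE exprVn sqr_sqrtr ?(ltW s0) // mulVf // gt_eqF.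
have [->|] := eqVneq x 0; last exact: low.
(* At the origin both sides are 0 unless k = 0, when they are constant. *)
have y0 := const_mx1_neq0 n0; set y := const_mx _ in y0.
rewrite -(scale0r y) (dhomog_meval _ _ pk) (dhomog_meval _ _ (dhomog_sqnorm R n)).
rewrite expr0n mul0r; case: k pk {tE eP} low => [|k] pk low.
  by have := low y y0; rewrite muln0 !expr0 mul1r.
by rewrite !expr0n /= mulr0 mul0r.
Qed.

Lemma polar_gauss_asymptotic_form (d : nat) (t : seq (R * 'X_{1..n})) :
  all (fun cm => mdeg cm.2 == d) t ->
  exists2 C : R, 0 <= C & forall l, exists2 p,
    l1_le d (C / l.+1%:R) p &
    \sum_(cm <- t) cm.1 *: polar (@gauss R n) (d + 2 * l) cm.2 =
      polar_const R d l *: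
        (sqnorm R n ^+ l * (\sum_(cm <- t) cm.1 *: 'X_[cm.2] + p)).
Proof.
elim: t => [_|[c m] t IH /= /andP[/eqP md /IH[C C0 Cp]]].
  exists 0 => // l; exists 0; first by rewrite mul0r; exact: l1_le0.
  by rewrite !big_nil addr0 mulr0 scaler0.
have [C' C'0 C'p] := polar_gauss_asymptotic R m.
exists (`|c| * C' + C) => [|l]; first by rewrite addr_ge0 // mulr_ge0.
have [p pC pE] := Cp l; have [p' p'C p'E] := C'p l; rewrite md in p'C p'E.
exists (c *: p' + p).
  by rewrite mulrDl -mulrA; apply: l1_leD => //; exact: l1_leZ.
rewrite !big_cons /= pE p'E -!mul_mpolyC; ring.
Qed.

(** Reznick's theorem: a power of [sqnorm] is a denominator for every positive
    definite form. With [q = h - e sqnorm^k] nonnegative on the whole space, the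
    expectation of [q(u) (u . X)^(2 k + 2 l)] is a sum of squares for every
    finitely supported [u]. When [u] approaches a Gaussian vector this becomes
    [sqnorm^l (q + r)] up to a constant and a small error, with [r] small for
    large [l]. The slack [e sqnorm^k] absorbs both errors, since [sqnorm^k]
    dominates forms with small coefficients. *)
Lemma reznick_uniform_denominator k h :
  (0 < n)%N -> h \is (2 * k).-homog -> positive_definite h ->
  exists N, sum_of_squares (sqnorm R n ^+ N * h).
Proof.
move=> n0 hk h0.
have [e e0 eP] := positive_definite_lower n0 hk h0.
pose S := sqnorm R n; pose q := h - e *: S ^+ k.
have q0 x : 0 <= q.@[x].
  have -> : q.@[x] = q.@[(\row_i x i) ord0].
    by apply: meval_eq => i; rewrite mxE.
  by rewrite mevalB mevalZ rmorphXn /= subr_ge0; exact: eP.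
have qk : q \is (2 * k).-homog.
  by rewrite rpredB // rpredZ //; apply: dhomogMn; exact: dhomog_sqnorm.
have [A [t [tk qE tA]]] := l1_le_dhomog qk.
have [C C0 Cp] := polar_gauss_asymptotic_form tk.
pose l := Num.bound (2 * C / e).
have Cl : C / l.+1%:R <= e / 2.
  rewrite ler_pdivrMr ?ltr0n // mulrC -ler_pdivrMr ?divr_gt0 //.
  apply: (@le_trans _ _ l%:R); last by rewrite ler_nat.
  have -> : C / (e / 2) = 2 * C / e by field; exact: lt0r_neq0.
  by apply: ltW; apply: archi_boundP; rewrite divr_ge0 ?mulr_ge0 // ltW.
have [r rC rE] := Cp l; exists l.
pose c := polar_const R (2 * k) l; have c0 : 0 < c by exact: polar_const_gt0.
pose J := (2 * k + 2 * l)%N.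
have A0 : 0 <= A by apply: le_trans tA; exact: sumr_ge0.
pose e' := c * (e / 2) / (n%:R ^+ J * (A + 1)).
have nJ0 : 0 < n%:R ^+ J :> R by rewrite exprn_gt0 // ltr0n.
have A1 : 0 < A + 1 by lra.
have e'0 : 0 < e' by apply: divr_gt0; apply: mulr_gt0 => //; exact: divr_gt0.
have [T [w [u [w0 uP]]]] := gauss_approx n (J + 2 * k) e'0.
pose E (m : 'X_{1..n}) := \sum_a w a * 'X_[m].@[u a].
pose Q := \sum_(cm <- t) cm.1 *: polar E J cm.2.
have Q0 : sum_of_squares Q.
  have -> : Q = \sum_a (w a * q.@[u a]) *: (\sum_i u a i *: 'X_i) ^+ J.
    rewrite /Q; under eq_bigr do rewrite polar_eval scaler_sumr.
    rewrite exchange_big; apply: eq_bigr => a _ /=.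
    rewrite qE raddf_sum /= mulr_sumr scaler_suml; apply: eq_bigr => cm _.
    by rewrite mevalZ scalerA mulrCA.
  apply: sos_sum => a _; apply: sosZ; first by rewrite mulr_ge0.
  by rewrite /J -mulnDr mulnC exprM; exact: sos_sqr.
(* The distance between the discrete and the Gaussian expectations. *)
have QG : l1_le (2 * (k + l)) (c * (e / 2)) (Q - c *: (S ^+ l * (q + r))).
  rewrite qE -rE /Q -sumrB mulnDr -/J.
  apply: (@l1_le_weaken _ _ _ ((\sum_(cm <- t) `|cm.1|) * (n%:R ^+ J * e'))).
    apply: (@le_trans _ _ ((A + 1) * (n%:R ^+ J * e'))).
      have X0 : 0 < n%:R ^+ J * e' by exact: mulr_gt0.
      by rewrite ler_pM2r //; apply: le_trans tA _; rewrite lerDl.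
    rewrite mulrA [(A + 1) * _]mulrC /e' mulrCA divff ?mulr1 //.
    by rewrite gt_eqF //; exact: mulr_gt0.
  elim: (t) tk => [_|cm t' IH /= /andP[/eqP cmk t'k]].
    by rewrite !big_nil mul0r; exact: l1_le0.
  rewrite !big_cons mulrDl; apply: l1_leD; last exact: IH.
  rewrite -scalerBr; apply: l1_leZ.
  by apply: (polar_approx uP); rewrite cmk.
have -> : S ^+ l * h = c^-1 *: (Q +
    ((c * (e / 2)) *: S ^+ (k + l) - (Q - c *: (S ^+ l * (q + r)))) +
    c *: (S ^+ l * ((e / 2) *: S ^+ k - r))).
  rewrite /q exprD.
  have {1}-> : S ^+ l * h = c^-1 *: (c *: (S ^+ l * h)).
    by rewrite scalerA mulVf ?scale1r // gt_eqF.
  have eE : e = e / 2 + e / 2 by lra.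
  rewrite [in h - _]eE; move: (e / 2) => f.
  by congr (_ *: _); rewrite -!mul_mpolyC; ring.
apply: sosZ; first by rewrite invr_ge0 ltW.
apply: sosD; first by apply: sosD => //; exact: l1_le_sos.
apply: sosZ; first exact: ltW.
apply: sosM; first exact: sos_sqnorm.
by apply: l1_le_sos; exact: l1_le_weaken rC.
Qed.

End PositiveDefiniteForms.

(** * Scheiderer's theorem and Lyapunov functions *)

Section Scheiderer.

Variables (R : realType) (n : nat).
Implicit Types (g h p q V : {mpoly R[n]}).

Lemma positive_definite_sub k p :
  (0 < n)%N -> p \is (2 * k).-homog -> positive_definite p ->
  exists e : R, [/\ 0 < e, p - e *: sqnorm R n ^+ k \is (2 * k).-homog
    & positive_definite (p - e *: sqnorm R n ^+ k)].
Proof.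
move=> n_gt0 pk p0; have [e e0 eP] := positive_definite_lower n_gt0 pk p0.
exists (e / 2); split; first exact: divr_gt0.
  by rewrite rpredB // rpredZ //; apply: dhomogMn; exact: dhomog_sqnorm.
move=> x x0; rewrite mevalB mevalZ rmorphXn /= subr_gt0.
apply: lt_le_trans (eP x).
by rewrite ltr_pM2r ?exprn_gt0 ?sqnorm_gt0 // ltr_pdivrMr // ltr_pMr // ltr1n.
Qed.

(** Scheiderer's theorem in the case where [g] is itself a sum of squares. Since
    [g] is bounded below by a multiple of [s^d], with [s = sqnorm], Reznick's
    theorem gives that [s^N (g - e s^d)] is a sum of squares; Woermann's trick
    turns it into a domination of a power of [s] by a power of [g]. The converse
    domination holds because powers of [s] dominate all forms. So the
    denominator that Reznick's theorem yields for [h] can be traded for a power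
    of [g]. *)
Lemma scheiderer_power_denominator d m g h :
  (0 < n)%N -> (0 < d)%N -> sum_of_squares g ->
  g \is (2 * d).-homog -> positive_definite g ->
  h \is (2 * m).-homog -> positive_definite h ->
  exists k, sum_of_squares (g ^+ k * h).
Proof.
move=> n_gt0 d0 gsos gd g0 hm h0; pose s := sqnorm R n.
have [e [e0 ge gep]] := positive_definite_sub n_gt0 gd g0.
have [N sosN] := reznick_uniform_denominator n_gt0 ge gep.
pose A := (s ^+ d) ^+ N.+1; pose G := g ^+ N.+1; pose c := e ^+ N.+1.
have c0 : 0 < c by exact: exprn_gt0.
have sdN : sum_of_squares (s ^+ d) by exact: sos_sqnorm.
(* G - c A is a multiple of g - e s^d by a sum of squares. *)
have AG : sum_of_squares (A * (G - c *: A)).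
  rewrite /G /c /A -exprZn subrXX -exprM.
  have -> : (d * N.+1 = (d * N.+1 - N) + N)%N by rewrite subnK //; nia.
  rewrite exprD -mulrA [s ^+ N * _]mulrA.
  apply: sosM; first exact: sos_sqnorm.
  apply: sosM => //; apply: sos_sum => i _.
  by apply: sosM; [exact: sosX|apply: sosX; apply: sosZ => //; exact: ltW].
have cAG := wormann_trick (ltW c0) AG.
pose D := (2 * (d * N.+1))%N.
have A2E : A ^+ 2 = s ^+ D by rewrite /A -!exprM; congr (_ ^+ _); rewrite /D; lia.
have [C GC] : exists C, l1_le (2 * D) C (G ^+ 2).
  apply: l1_le_dhomog; rewrite /G -exprM.
  have -> : (2 * D = 2 * d * (N.+1 * 2))%N by rewrite /D; lia.
  exact: dhomogMn.
have GCA : G ^+ 2 <=sos (`|C| + 1) *: A ^+ 2.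
  rewrite A2E; apply: l1_le_sos; apply: l1_le_weaken GC.
  by have := ler_norm C; lra.
have [e' [e'0 hh hp]] := positive_definite_sub n_gt0 hm h0.
set h' := h - _ in hh hp.
have [M sosM'] := reznick_uniform_denominator n_gt0 hh hp.
have AMh' : sum_of_squares ((A ^+ 2) ^+ M * h').
  have -> : (A ^+ 2) ^+ M * h' = s ^+ (D * M - M) * (s ^+ M * h').
    rewrite mulrA -exprD A2E -exprM; congr (_ ^+ _ * _).
    by rewrite subnK // /D; nia.
  by apply: sosM => //; exact: sos_sqnorm.
have [B hB] := l1_le_dhomog hh.
have h'B : sum_of_squares (h' + B *: s ^+ m).
  rewrite addrC -[h']opprK; apply: l1_le_sos.
  by rewrite -scaleN1r -[B]mul1r -[X in X * B](normr1 R) -normrN; exact: l1_leZ.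
have c20 : 0 < c ^+ 2 by exact: exprn_gt0.
have C0 : 0 < `|C| + 1 by have := normr_ge0 C; lra.
have [k kP] := sos_clear_denominator c20 C0 e'0 (sos_sqr A) (sos_sqr G)
  (sos_sqnorm R n m) cAG GCA AMh' h'B.
exists (N.+1 * 2 * k)%N; rewrite !exprM -/G.
by rewrite -[h](subrK (e' *: s ^+ m)).
Qed.

End Scheiderer.

Section Lyapunov.

Variables (R : realType) (n : nat) (f : 'I_n -> {mpoly R[n]}).
Implicit Types V : {mpoly R[n]}.

Lemma mderiv_exp i V k :
  (V ^+ k.+1)^`M(i) = k.+1%:R *: (V ^+ k * V^`M(i)).
Proof.
elim: k => [|k IH]; first by rewrite expr1 expr0 mul1r scale1r.
rewrite exprS mderivM IH -(natr1 k.+1) -!mul_mpolyC exprS.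
by move: (k.+1%:R) => c; ring.
Qed.

Lemma lie_derivative_exp V k :
  lie_derivative f (V ^+ k.+1) = k.+1%:R *: (V ^+ k * lie_derivative f V).
Proof.
rewrite /lie_derivative mulr_sumr scaler_sumr; apply: eq_bigr => i _.
by rewrite mderiv_exp -scalerAl mulrA.
Qed.

Lemma dhomog_mderiv d i V : V \is d.-homog -> V^`M(i) \is d.-1.-homog.
Proof.
move=> /dhomogP Vd; rewrite [V]mpolyE raddf_sum big_seq.
apply: rpred_sum => m /Vd /= md; rewrite mderivZ mderivX scalerA.
have [->|mi] := eqVneq (m i) 0%N; first by rewrite mulr0 scale0r rpred0.
rewrite rpredZ // dhomogX /= -md.
have mE : m = (m - U_(i) + U_(i))%MM by rewrite submK // lep1mP.
by rewrite {2}mE mdegD mdeg1 addn1.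
Qed.

Lemma dhomog_lie_derivative d e V :
  V \is d.-homog -> (forall i, f i \is e.-homog) ->
  lie_derivative f V \is (d.-1 + e).-homog.
Proof.
move=> Vd fe; apply: rpred_sum => i _.
by apply: dhomogM => //; exact: dhomog_mderiv.
Qed.

Lemma homogeneous_lyapunov_exp V k :
  homogeneous_lyapunov f V -> homogeneous_lyapunov f (V ^+ k.+1).
Proof.
case=> -[d Vd] V0 Vinf Vpos V'pos; split.
- by exists (d * k.+1)%N; exact: dhomogMn.
- by rewrite rmorphXn /= V0 expr0n.
- move=> M; have [r rP] := Vinf (Num.max M 1); exists r => x /rP.
  rewrite gt_max rmorphXn /= => /andP[MV V1]; apply: lt_le_trans MV _.
  by rewrite -[leLHS]expr1; apply: ler_weXn2l => //; exact: ltW.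
- by move=> x /Vpos V1; rewrite rmorphXn /= exprn_gt0.
- move=> x x0; rewrite lie_derivative_exp -scalerN -mulrN.
  rewrite mevalZ mevalM rmorphXn /= !mulr_gt0 ?ltr0n ?exprn_gt0 //.
  + exact: Vpos.
  + exact: V'pos.
Qed.

End Lyapunov.

Theorem theorem4p8 (R : realType) (n : nat) (f : 'I_n -> {mpoly R[n]}) :
  homogeneous_vector_field f ->
  (exists V : {mpoly R[n]}, homogeneous_lyapunov f V) ->
  exists W : {mpoly R[n]},
    [/\ homogeneous_lyapunov f W,
        sum_of_squares W
      & sum_of_squares (- lie_derivative f W)].
Proof.
move=> [_ [df fd]] [V lyapV].
(* With W = V^(2 k + 2), the derivative of W is a positive multiple of
   V^(2 k + 1) times that of V. *)
suff [k kP] : exists k, sum_of_squares ((V ^+ 2) ^+ k * (V * - lie_derivative f V)).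
  exists (V ^+ (2 * k).+2); split; first exact: homogeneous_lyapunov_exp.
    by rewrite (_ : (2 * k).+2 = k.+1 * 2)%N ?exprM; [exact: sos_sqr|lia].
  rewrite lie_derivative_exp -scalerN -mulrN; apply: sosZ => //.
  by rewrite exprSr exprM -mulrA.
case: lyapV => -[d Vd] V0 _ Vpos V'pos.
have [n0|n0] := posnP n.
  exists 0%N; rewrite /lie_derivative big1 ?oppr0 ?mulr0; first exact: sos0.
  by move=> i; have := ltn_ord i; rewrite [X in (_ < X)%N]n0.
have prod_pos : positive_definite (V * - lie_derivative f V).
  by move=> x x0; rewrite mevalM mulr_gt0 ?Vpos ?V'pos.
have prodd : V * - lie_derivative f V \is (d + (d.-1 + df)).-homog.
  by apply: dhomogM => //; rewrite rpredN; exact: dhomog_lie_derivative.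
have d0 : (0 < d)%N.
  rewrite lt0n; apply/eqP => d0; rewrite d0 in Vd.
  have x0 := const_mx1_neq0 R n0; set x := const_mx _ in x0.
  have := Vpos x x0; rewrite -[V.@[_]]mul1r -(expr0 (0 : R)).
  by rewrite -(dhomog_meval _ _ Vd) scale0r V0 ltxx.
have := positive_definite_even n0 prodd prod_pos.
rewrite -dvdn2 => /dvdnP[m mE]; rewrite mE mulnC in prodd.
apply: (scheiderer_power_denominator n0 d0 (sos_sqr V) _ _ prodd prod_pos).
  by rewrite mulnC; exact: dhomogMn.
by move=> x /Vpos V1; rewrite rmorphXn /= exprn_gt0.
Qed.
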